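(* Assume: (Balanced panel of groups) $N_{g,t}>0$ for all $(g,t)$. (Sharp design) $D_{i,g,t}=D_{g,t}$ for all $(g,t)$ and all $i\in\{1,\ldots,N_{g,t}\}$. (Mean independence) $\mathrm{E}[Y_{g,t}(0)\mid\mathbf{D}]=\mathrm{E}[Y_{g,t}(0)\mid\mathbf{D}_g]$ for all $(g,t)\in\{1,\ldots,G\}\times\{1,\ldots,T\}$. (Strong exogeneity) $\mathrm{E}[Y_{g,t}(0)-Y_{g,t-1}(0)\mid\mathbf{D}_g]=\mathrm{E}[Y_{g,t}(0)-Y_{g,t-1}(0)]$ for all $g$ and all $t\in\{2,\ldots,T\}$. (Parallel trends) $\mathrm{E}[Y_{g,t}(0)-Y_{g,t-1}(0)]=\mathrm{E}[Y_{k,t}(0)-Y_{k,t-1}(0)]$ for all groups $g,k$ and all $t\in\{2,\ldots,T\}$. (Homogeneous treatment effects) There is a constant $\Delta\in\mathbb{R}$ such that $Y_{i,g,t}(1)-Y_{i,g,t}(0)=\Delta$ for all $i,g,t$. Suppose also $\mathrm{E}[|\widehat\beta_{fe}|]<\infty$. Then $$\mathrm{E}[\widehat\beta_{fe}]=\Delta\,\mathrm{E}\left[\frac{\sum_{(g,t)}\frac{N_{g,t}}{N_1}\varepsilon_{g,t}\left(\frac1{N_{g,t}}\sum_{i=1}^{N_{g,t}}\Pr(D^*_{i,g,t}=1\mid\mathbf{D})\right)}{\sum_{(g,t)}\frac{N_{g,t}}{N_1}\varepsilon_{g,t}D_{g,t}}\right].$$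
   Context: There are $G$ groups and $T\ge2$ periods. Each cell $(g,t)\in\{1,\ldots,G\}\times\{1,\ldots,T\}$ contains $N_{g,t}$ units $i\in\{1,\ldots,N_{g,t}\}$ (cell sizes are non-random). Each unit has real-valued random potential outcomes $Y_{i,g,t}(0),Y_{i,g,t}(1)$, a latent (true) binary treatment status $D^*_{i,g,t}$ and an observed binary treatment status $D_{i,g,t}$ which may differ from $D^*_{i,g,t}$. The observed outcome is $Y_{i,g,t}=D^*_{i,g,t}Y_{i,g,t}(1)+(1-D^*_{i,g,t})Y_{i,g,t}(0)$. Cell averages: $D_{g,t}=\frac1{N_{g,t}}\sum_iD_{i,g,t}$, and likewise $Y_{g,t}$, $Y_{g,t}(0)$. $\mathbf{D}_g=(D_{g,t})_{t}$, $\mathbf{D}=(D_{g,t})_{(g,t)}$. $\widehat\beta_{fe}$ is the two-way fixed effects estimator: the coefficient on $D_{i,g,t}$ in the unit-level OLS regression of $Y_{i,g,t}$ on group fixed effects, period fixed effects and $D_{i,g,t}$. $\varepsilon_{g,t}$ is the residual in cell $(g,t)$ from the unit-level OLS regression of $D_{g,t}$ on group and period fixed effects (equivalently, the cell-level regression weighted by $N_{g,t}$). $N_1=\sum_{(g,t)}N_{g,t}D_{g,t}$ is the number of units observed as treated. It is understood that $\widehat\beta_{fe}$ is well defined, i.e. $\sum_{(g,t)}N_{g,t}\varepsilon_{g,t}D_{g,t}\neq0$ almost surely. Equalities between conditional expectations are almost sure. *)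

(* Defs.v *)
From HB Require Import structures.
From mathcomp Require Import all_boot all_order all_algebra.
From mathcomp Require Import all_classical all_reals all_analysis.
From mathcomp Require Import measurable_realfun lebesgue_integral.

Set Implicit Arguments.
Unset Strict Implicit.
Unset Printing Implicit Defensive.

Import Order.TTheory GRing.Theory Num.Theory.

Local Open Scope classical_set_scope.
Local Open Scope ring_scope.

Section ConditionalExpectation.
Context {d : measure_display} {Om : measurableType d} {R : realType}.
Variable P : probability Om R.

(* [<<s preimages X >>] is the sigma-algebra sigma(X_i, i in I). *)
Definition preimages (I : Type) (X : I -> Om -> R) : set (set Om) :=
  [set A | exists i (B : set R), measurable B /\ A = X i @^-1` B].

Definition is_condexp (I : Type) (X : I -> Om -> R) (Y Z : Om -> R) : Prop :=
  [/\ measurable_fun setT (Z : g_sigma_algebraType (preimages X) -> R),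
      P.-integrable setT (EFin \o Z) &
      forall A : set Om, <<s preimages X >> A ->
        (\int[P]_(w in A) (Z w)%:E = \int[P]_(w in A) (Y w)%:E)%E].

(* A version of E[Y | X_i, i in I], determined only almost surely. It exists for
   every integrable Y ([condexpP]); the value is 0 when no version exists. *)
Definition condexp (I : Type) (X : I -> Om -> R) (Y : Om -> R) : Om -> R :=
  xget (cst 0) [set Z | is_condexp X Y Z].

Definition condprob (I : Type) (X : I -> Om -> R) (A : set Om) : Om -> R :=
  condexp X (\1_A).

Lemma sigma_preimages_measurable (I : Type) (X : I -> Om -> R) :
  (forall i, measurable_fun setT (X i)) ->
  <<s preimages X >> `<=` measurable.
Proof.
move=> mX; apply: smallest_sub; first exact: sigma_algebra_measurable.
by move=> _ [i [B [mB ->]]]; rewrite -[X in measurable X]setTI; exact: mX.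
Qed.

Lemma condexpP (I : Type) (X : I -> Om -> R) (Y : Om -> R) :
  (forall i, measurable_fun setT (X i)) ->
  P.-integrable setT (EFin \o Y) ->
  is_condexp X Y (condexp X Y).
Proof.
move=> mX iY; rewrite /condexp.
suff [Z hZ] : exists Z, is_condexp X Y Z.
  by case: xgetP => [Z' _ //|/(_ Z)]; case.
pose S := g_sigma_algebraType (preimages X).
pose h : Om -> S := id.
have mh : measurable_fun setT h.
  by move=> _ A mA; rewrite setTI; exact: (sigma_preimages_measurable mX).
have mS (A : set S) : measurable A -> (measurable (A : set Om)).
  exact: (sigma_preimages_measurable mX).
pose Qf : set S -> \bar R := fun A => P A.
have Q0 : Qf set0 = 0%E by exact: measure0.
have Qge0 A : (0 <= Qf A)%E by exact: measure_ge0.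
have Qadd : semi_sigma_additive Qf.
  move=> F mF tF mUF; apply: measure_semi_sigma_additive => //.
  - by move=> n; apply: mS.
  - exact: mS.
pose Qm := isMeasure.Build _ S R Qf Q0 Qge0 Qadd.
pose Q1 : {measure set S -> \bar R} := HB.pack Qf Qm.
have Qfin : fin_num_fun Q1.
  by move=> A mA; apply: fin_num_measure; exact: mS.
pose Qfm := @Measure_isFinite.Build _ S R Q1 Qfin.
pose Q : {finite_measure set S -> \bar R} := HB.pack Qf Qm Qfm.
pose nuf : set S -> \bar R := fun A => induced_charge iY A.
have nu0 : nuf set0 = 0%E by exact: charge0.
have nufin A : measurable A -> nuf A \is a fin_num.
  by move=> mA; apply: fin_num_measure; exact: mS.
have nuadd : semi_sigma_additive nuf.
  move=> F mF tF mUF; apply: charge_semi_sigma_additive => //.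
  - by move=> n; apply: mS.
  - exact: mS.
pose num := isCharge.Build _ S R nuf nu0 nufin nuadd.
pose nu : {charge set S -> \bar R} := HB.pack nuf num.
have dom : nu `<< Q.
  apply/null_content_dominatesP => A mA PA0.
  rewrite /nu /= /nuf /induced_charge; apply: null_set_integral => //.
    exact: mS.
  exact: (@measurable_funS _ _ Om _ setT A _ measurableT (@subsetT _ A) (measurable_int _ iY)).
have [f [ffin fint fE]] := charge.Radon_Nikodym0 dom.
have mf := measurable_int _ fint.
exists (fine \o f).
have fEfin : EFin \o (fine \o f) = f by apply/funext => x /=; rewrite fineK.
have fP : P.-integrable setT f.
  apply/integrableP; split.
    by move=> _ B mB; rewrite setTI; apply: mS; rewrite -[X in measurable X]setTI; exact: mf.
  move/integrableP : (fint) => [_]; apply: le_lt_trans.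
  have maf := measurableT_comp (@abse_measurable R setT) mf.
  have E := @ge0_integral_pushforward _ _ _ _ _ h mh P setT (abse \o f)
    measurableT maf ltac:(by move=> x _; exact: abse_ge0).
  have -> : (\int[Q]_x `|f x| = \int[pushforward P h]_x `|f x|)%E by [].
  by rewrite E preimage_setT.
split.
- by apply/measurable_EFinP; rewrite fEfin.
- by rewrite fEfin.
- move=> A mA.
  under eq_integral do rewrite fineK//.
  have -> : (\int[P]_(w in A) (Y w)%:E = nu A)%E by [].
  rewrite (fE A mA).
  have iA : P.-integrable (h @^-1` A) (f \o h).
    exact: (integrableS measurableT (mS _ mA) (@subsetT _ A) fP).
  exact/esym/(integral_pushforward mh mf iA mA).
Qed.

End ConditionalExpectation.

Section TwoWayFixedEffects.
Context {R : realType} {G T : nat}.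
Variable N : 'I_G -> 'I_T -> nat.

(* One value for each unit i of each cell (g,t). *)
Definition unit_data (V : Type) := forall g t, 'I_(N g t) -> V.

Definition cell_avg (x : unit_data R) (g : 'I_G) (t : 'I_T) : R :=
  (N g t)%:R^-1 * \sum_(i < N g t) x g t i.

Definition fe_ssr (y x : unit_data R) (a : 'I_G -> R) (c : 'I_T -> R) (b : R) : R :=
  \sum_(g < G) \sum_(t < T) \sum_(i < N g t)
    (y g t i - (a g + c t + b * x g t i)) ^+ 2.

(* The full sets of group and period dummies are collinear, so the fixed effects
   [a] and [c] are never unique; [b] is unique exactly when x is not a linear
   combination of the dummies. *)
Definition is_twfe_coef (y x : unit_data R) (b : R) : Prop :=
  exists a c, forall a' c' b', fe_ssr y x a c b <= fe_ssr y x a' c' b'.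

(* The unit-level regression of the cell variable x on the dummies alone; the
   fitted values are unique when every cell is nonempty. *)
Definition is_fe_residual (x e : 'I_G -> 'I_T -> R) : Prop :=
  exists a c,
    (forall a' c',
      \sum_(g < G) \sum_(t < T) \sum_(i < N g t) (x g t - (a g + c t)) ^+ 2 <=
      \sum_(g < G) \sum_(t < T) \sum_(i < N g t) (x g t - (a' g + c' t)) ^+ 2) /\
    forall g t, e g t = x g t - (a g + c t).

End TwoWayFixedEffects.

Arguments unit_data {G T} N V.

(* Main.v *)
(** By Frisch-Waugh-Lovell the estimator is, almost surely, a weighted sum over
    cells of the averages of [Y0 + Delta * Dstar], whose weights are functions
    of [D] alone.  As [D] takes finitely many values, the weights can be pulled
    out of conditional expectations given [D].  Exogeneity and parallel trends
    make [E[Y0_gt | D]] the sum of a group term and a deterministic period term,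
    which the weights annihilate since regression residuals are orthogonal to
    the fixed effects. *)

Require Import Defs.
From mathcomp Require Import all_boot all_order all_algebra.
From mathcomp Require Import all_classical all_reals all_analysis.
From mathcomp Require Import measurable_realfun ring lra.

Set Implicit Arguments.
Unset Strict Implicit.
Unset Printing Implicit Defensive.

Import Order.TTheory GRing.Theory Num.Theory.

Local Open Scope classical_set_scope.
Local Open Scope ring_scope.

(** * Algebra of conditional expectations *)

Section ConditionalExpectationTheory.
Context {d : measure_display} {Om : measurableType d} {R : realType}.
Context (P : probability Om R) (I : Type) (X : I -> Om -> R)
  (mX : forall i, measurable_fun setT (X i)).

Local Notation integrable f := (P.-integrable setT (EFin \o f)).

Lemma integrable_EFinD (Y Y' : Om -> R) :
  integrable Y -> integrable Y' -> integrable (fun w => Y w + Y' w).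
Proof. by move=> iY iY'; exact: (integrableD measurableT iY iY'). Qed.

Lemma integrable_EFinZ (k : R) (Y : Om -> R) :
  integrable Y -> integrable (fun w => k * Y w).
Proof. by move=> iY; exact: (integrableZl measurableT k iY). Qed.

Lemma indic_mulE (A : set Om) (Y : Om -> R) :
  EFin \o (fun w => \1_A w * Y w) = (EFin \o Y) \_ A.
Proof.
apply/funext => w; rewrite patchE /= indicE.
by case: (w \in A); rewrite ?mul1r ?mul0r.
Qed.

Lemma integrable_indicM (A : set Om) (Y : Om -> R) :
  measurable A -> integrable Y -> integrable (fun w => \1_A w * Y w).
Proof.
move=> mA iY; rewrite indic_mulE -integrable_mkcond//.
exact: (integrableS measurableT mA).
Qed.

Lemma is_condexp0 : is_condexp P X (cst 0) (cst 0).
Proof. by split=> //; exact: integrable0. Qed.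

Lemma is_condexpD (Y Z Y' Z' : Om -> R) :
  integrable Y -> integrable Y' ->
  is_condexp P X Y Z -> is_condexp P X Y' Z' ->
  is_condexp P X (fun w => Y w + Y' w) (fun w => Z w + Z' w).
Proof.
move=> iY iY' [mZ iZ hZ] [mZ' iZ' hZ']; split.
- exact: measurable_funD.
- exact: integrable_EFinD.
- move=> A sA; have mA := sigma_preimages_measurable mX sA.
  have iA (U : Om -> R) : integrable U -> P.-integrable A (EFin \o U).
    exact: (integrableS measurableT mA).
  under eq_integral do rewrite EFinD.
  under [RHS]eq_integral do rewrite EFinD.
  rewrite !integralD//; [by rewrite hZ// hZ'|..].
  all: solve [exact: iA iY|exact: iA iY'|exact: iA iZ|exact: iA iZ'].
Qed.

Lemma is_condexpZ (k : R) (Y Z : Om -> R) :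
  integrable Y -> is_condexp P X Y Z ->
  is_condexp P X (fun w => k * Y w) (fun w => k * Z w).
Proof.
move=> iY [mZ iZ hZ]; split.
- exact: measurable_funM.
- exact: integrable_EFinZ.
- move=> A sA; have mA := sigma_preimages_measurable mX sA.
  have iA (U : Om -> R) : integrable U -> P.-integrable A (EFin \o U).
    exact: (integrableS measurableT mA).
  under eq_integral do rewrite EFinM.
  under [RHS]eq_integral do rewrite EFinM.
  rewrite !integralZl//; [by rewrite hZ|..].
  all: solve [exact: iA iY|exact: iA iZ].
Qed.

Lemma is_condexp_sum (J : Type) (s : seq J) (Y Z : J -> Om -> R) :
  (forall j, integrable (Y j)) -> (forall j, is_condexp P X (Y j) (Z j)) ->
  integrable (fun w => \sum_(j <- s) Y j w) /\
  is_condexp P X (fun w => \sum_(j <- s) Y j w) (fun w => \sum_(j <- s) Z j w).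
Proof.
move=> iY cY; elim: s => [|j s [iS cS]].
  have E (U : J -> Om -> R) : (fun w => \sum_(j <- [::]) U j w) = cst 0.
    by apply/funext => w; rewrite big_nil.
  by rewrite !E; split; [exact: integrable0|exact: is_condexp0].
have E (U : J -> Om -> R) : (fun w => \sum_(j <- j :: s) U j w) =
    (fun w => U j w + (fun v => \sum_(j <- s) U j v) w).
  by apply/funext => w; rewrite big_cons.
by rewrite !E; split; [exact: integrable_EFinD|exact: is_condexpD].
Qed.

(** The indicator turns an integral over [B] into one over the intersection of [A] and [B], which
    again belongs to the sigma-algebra generated by [X]. *)
Lemma is_condexp_indicM (A : set Om) (Y Z : Om -> R) :
  <<s preimages X >> A -> is_condexp P X Y Z ->
  is_condexp P X (fun w => \1_A w * Y w) (fun w => \1_A w * Z w).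
Proof.
move=> sA [mZ iZ hZ]; have mA := sigma_preimages_measurable mX sA.
split.
- have mI :=
    @measurable_indic _ (g_sigma_algebraType (preimages X)) R setT A sA.
  exact: measurable_funM mI mZ.
- exact: integrable_indicM.
- move=> B sB.
  have E (U : Om -> R) : (\int[P]_(w in B) (\1_A w * U w)%:E =
      \int[P]_(w in B `&` A) (U w)%:E)%E.
    by rewrite integral_mkcondr -indic_mulE.
  rewrite !E hZ//.
  exact: (@measurableI _ (g_sigma_algebraType (preimages X)) B A).
Qed.

(** The factor is the finite sum of [v k] times the indicator of the event [K = k], so linearity
    reduces the claim to indicators. Having finitely many values also keeps the product
    integrable. *)
Lemma is_condexp_pull_out (F : finType) (K : Om -> F) (v : F -> R)
    (Y Z : Om -> R) :
  (forall k, <<s preimages X >> (K @^-1` [set k])) ->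
  integrable Y -> is_condexp P X Y Z ->
  integrable (fun w => v (K w) * Y w) /\
  is_condexp P X (fun w => v (K w) * Y w) (fun w => v (K w) * Z w).
Proof.
move=> sK iY cY.
have E (U : Om -> R) : (fun w => v (K w) * U w) =
    (fun w => \sum_k v k * (\1_(K @^-1` [set k]) w * U w)).
  apply/funext => w; rewrite (bigD1 (K w))//= big1 => [|k kw]; last first.
    by rewrite indicE memNset ?mul0r ?mulr0// => /= /esym/eqP; exact/negP.
  by rewrite indicE mem_set// mul1r addr0.
rewrite !E; have iK k := integrable_indicM (sigma_preimages_measurable mX (sK k)) iY.
apply: is_condexp_sum => k; first exact: integrable_EFinZ.
by apply: is_condexpZ => //; exact: is_condexp_indicM.
Qed.

(* [U = Z - Z'] is a version of [E[0 | X]]; pulling out its sign gives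
   [E|U| = 0]. *)
Lemma is_condexp_unique (Y Z Z' : Om -> R) : integrable Y ->
  is_condexp P X Y Z -> is_condexp P X Y Z' -> \forall w \ae P, Z w = Z' w.
Proof.
move=> iY cZ cZ'; pose U w := Z w + -1 * Z' w.
have cU : is_condexp P X (cst 0) U.
  have -> : cst 0 = (fun w => Y w + -1 * Y w).
    by apply/funext => w /=; ring.
  apply: is_condexpD => //; first exact: integrable_EFinZ.
  exact: is_condexpZ.
have [mU iU _] := cU.
pose s (b : bool) : R := if b then 1 else -1.
have sU (k : bool) : <<s preimages X >> ((fun w => 0 <= U w) @^-1` [set k]).
  have m0 : <<s preimages X >> [set w | 0 <= U w].
    have := mU measurableT _ (measurable_itv `[0, +oo[).
    rewrite setTI; congr (<<s _ >> _); apply/seteqP.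
    by split=> w /=; rewrite in_itv/= andbT.
  case: k.
    by congr (<<s _ >> _) : m0; apply/seteqP; split.
  have := @measurableC _ (g_sigma_algebraType (preimages X)) _ m0.
  by congr (<<s _ >> _); apply/seteqP; split=> w /=; [move/negP/negbTE|move=> ->].
have [_ [_ _ /(_ setT)]] := is_condexp_pull_out s sU (integrable0 _ _) cU.
move=> /(_ (@measurableT _ (g_sigma_algebraType (preimages X)))).
under [RHS]eq_integral do rewrite mulr0.
rewrite integral0 => hU.
have mEU := measurable_int _ iU.
have : ae_eq P setT (EFin \o U) (cst 0).
  apply/(ae_eq_integral_abs P measurableT mEU); rewrite -hU.
  apply: eq_integral => w _ /=; congr EFin; rewrite /s.
  case: (lerP 0 (U w)) => Uw; first by rewrite mul1r ger0_norm.
  by rewrite mulN1r ltr0_norm.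
apply: filterS => w /(_ Logic.I) [] ; rewrite /U mulN1r => /eqP.
by rewrite subr_eq0 => /eqP.
Qed.

(** [condexp] picks some version, so linearity holds only almost surely, by uniqueness of
    versions. *)
Lemma condexpB (Y Y' : Om -> R) : integrable Y -> integrable Y' ->
  \forall w \ae P, condexp P X (fun v => Y v - Y' v) w =
    condexp P X Y w - condexp P X Y' w.
Proof.
move=> iY iY'.
have -> : (fun v => Y v - Y' v) = (fun v => Y v + -1 * Y' v).
  by apply/funext => v; rewrite mulN1r.
have iB := integrable_EFinD iY (integrable_EFinZ (-1) iY').
have : \forall w \ae P, condexp P X (fun v => Y v + -1 * Y' v) w =
    condexp P X Y w + -1 * condexp P X Y' w.
  apply: is_condexp_unique; [exact: iB|exact: condexpP|].
  apply: is_condexpD => //; [exact: integrable_EFinZ|exact: condexpP|].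
  by apply: is_condexpZ => //; exact: condexpP.
by apply: filterS => w ->; rewrite mulN1r.
Qed.

End ConditionalExpectationTheory.

(** * Normal equations and the Frisch-Waugh-Lovell identity *)

Section LeastSquares.
Context {R : realType}.

(* If [L <> 0], [s = L / (|M| + 1)] violates the hypothesis. *)
Lemma quadratic_min_at0 (q0 L M : R) :
  (forall s, q0 <= q0 - 2 * s * L + s ^+ 2 * M) -> L = 0.
Proof.
move=> h; have [//|L0] := eqVneq L 0; exfalso.
have L2 : 0 < L ^+ 2 by rewrite lt_def sqr_ge0 sqrf_eq0 L0.
pose k := (`|M| + 1)^-1.
have k0 : 0 < k by rewrite invr_gt0 ltr_wpDl.
have kM : k * M <= 1.
  rewrite ler_pdivrMl ?ltr_wpDl// mulr1.
  by rewrite (le_trans (ler_norm M))// lerDl.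
have := h (k * L); rewrite -subr_ge0 => {}h.
have : 0 <= k * L ^+ 2 * (k * M - 2).
  by apply: le_trans h _; rewrite le_eqVlt; apply/orP; left; apply/eqP; ring.
rewrite (pmulr_rge0 _ (mulr_gt0 k0 L2)) => h2; lra.
Qed.

(** Expanding the squares gives a quadratic polynomial in [s], minimal at 0, whose linear
    coefficient is -2 times the inner product. *)
Lemma least_squares_orthogonal (J : finType) (r u : J -> R) :
  (forall s, \sum_j r j ^+ 2 <= \sum_j (r j - s * u j) ^+ 2) ->
  \sum_j r j * u j = 0.
Proof.
move=> h; apply: (@quadratic_min_at0 (\sum_j r j ^+ 2) _ (\sum_j u j ^+ 2)) => s.
apply: le_trans (h s) _; rewrite le_eqVlt; apply/orP; left; apply/eqP.
rewrite !mulr_sumr -sumrB -big_split/=; apply: eq_bigr => j _; ring.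
Qed.

Context {G T : nat} (N : 'I_G -> 'I_T -> nat).

(** Flattens the units of all cells into one finite index type, so that [least_squares_orthogonal]
    applies. *)
Lemma sum_units (F : unit_data N R) :
  \sum_g \sum_t \sum_(i < N g t) F g t i =
  \sum_(p : {c : 'I_G * 'I_T & 'I_(N c.1 c.2)})
     F (tag p).1 (tag p).2 (tagged p).
Proof.
rewrite pair_bigA/= (sig_big_dep (J := fun c : 'I_G * 'I_T => 'I_(N c.1 c.2))
  xpredT (fun _ _ => true) (fun c i => F c.1 c.2 i)).
exact: eq_bigr.
Qed.

(** Moving the minimizer along ([alpha], [gam], [k]) subtracts a multiple of that combination of
    regressors from the residual. *)
Lemma twfe_normal_equations (y x : unit_data N R) (b : R) :
  is_twfe_coef y x b -> exists a c, forall alpha gam k,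
  \sum_g \sum_t \sum_(i < N g t)
    (y g t i - (a g + c t + b * x g t i)) * (alpha g + gam t + k * x g t i) = 0.
Proof.
move=> [a [c h]]; exists a, c => alpha gam k.
rewrite sum_units; apply: least_squares_orthogonal => s.
have := h (fun g => a g + s * alpha g) (fun t => c t + s * gam t) (b + s * k).
rewrite /fe_ssr !sum_units; congr (_ <= _); apply: eq_bigr => p _; ring.
Qed.

(** The same perturbation argument, with dummies only; the factor [N g t] counts the identical terms
    of a cell. *)
Lemma fe_residual_normal_equations (x e : 'I_G -> 'I_T -> R) :
  is_fe_residual N x e -> forall alpha gam,
  \sum_g \sum_t (N g t)%:R * e g t * (alpha g + gam t) = 0.
Proof.
move=> [a [c [h he]]] alpha gam.
rewrite -[LHS](_ : \sum_g \sum_t \sum_(i < N g t)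
    (x g t - (a g + c t)) * (alpha g + gam t) = _); last first.
  apply: eq_bigr => g _; apply: eq_bigr => t _.
  by rewrite sumr_const card_ord -he -mulr_natl; ring.
rewrite (sum_units (fun g t _ => _)); apply: least_squares_orthogonal => s.
have := h (fun g => a g + s * alpha g) (fun t => c t + s * gam t).
rewrite !(sum_units (fun g t _ => _)); congr (_ <= _); apply: eq_bigr => p _.
all: ring.
Qed.

(** The difference of two residuals is a group term plus a period term, to which both residuals are
    orthogonal. Its [N]-weighted squared norm is therefore zero, and positive weights make it vanish
    in each cell. *)
Lemma fe_residual_unique (x e e' : 'I_G -> 'I_T -> R) :
  (forall g t, (0 < N g t)%N) ->
  is_fe_residual N x e -> is_fe_residual N x e' -> e = e'.
Proof.
move=> N0 re re'.
have [a [c [_ he]]] := re; have [a' [c' [_ he']]] := re'.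
have hee g t : e g t - e' g t = (a' g - a g) + (c' t - c t).
  by rewrite he he'; ring.
have S0 : \sum_g \sum_t (N g t)%:R * (e g t - e' g t) ^+ 2 = 0.
  transitivity
    (\sum_g \sum_t (N g t)%:R * e g t * ((a' g - a g) + (c' t - c t)) -
     \sum_g \sum_t (N g t)%:R * e' g t * ((a' g - a g) + (c' t - c t))).
    rewrite -sumrB; apply: eq_bigr => g _; rewrite -sumrB; apply: eq_bigr => t _.
    by rewrite -hee; ring.
  rewrite (fe_residual_normal_equations re (fun g => a' g - a g) (fun t => c' t - c t)).
  rewrite (fe_residual_normal_equations re' (fun g => a' g - a g) (fun t => c' t - c t)).
  by rewrite subrr.
apply/funext => g; apply/funext => t.
have ge0 g' t' : 0 <= (N g' t')%:R * (e g' t' - e' g' t') ^+ 2.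
  by rewrite mulr_ge0// sqr_ge0.
have Sg := psumr_eq0P (fun g' _ => sumr_ge0 _ (fun t' _ => ge0 g' t')) S0.
have /eqP : (N g t)%:R * (e g t - e' g t) ^+ 2 = 0.
  exact: (psumr_eq0P (fun t' _ => ge0 g t') (Sg g isT)).
by rewrite mulf_eq0 pnatr_eq0 gtn_eqF//= sqrf_eq0 subr_eq0 => /eqP.
Qed.

(** Split [y] into fixed effects, [b] times [x] and a residual. The first part is orthogonal to [e];
    so is the last, because [e] is itself a combination of the regressors. The undivided form needs
    no condition on the denominator. *)
Lemma frisch_waugh_lovell (y : unit_data N R) (x e : 'I_G -> 'I_T -> R)
    (b : R) :
  is_twfe_coef y (fun g t _ => x g t) b -> is_fe_residual N x e ->
  b * (\sum_g \sum_t (N g t)%:R * e g t * x g t) =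
  \sum_g \sum_t e g t * \sum_(i < N g t) y g t i.
Proof.
move=> /twfe_normal_equations[a [c hb]] re.
have [a' [c' [_ he]]] := re.
have -> : \sum_g \sum_t e g t * (\sum_(i < N g t) y g t i) =
    \sum_g \sum_t (N g t)%:R * e g t * (a g + c t) +
    b * (\sum_g \sum_t (N g t)%:R * e g t * x g t) +
    \sum_g \sum_t \sum_(i < N g t) (y g t i - (a g + c t + b * x g t)) *
      (- a' g + - c' t + 1 * x g t).
  rewrite mulr_sumr -!big_split/=; apply: eq_bigr => g _.
  rewrite mulr_sumr -!big_split/=; apply: eq_bigr => t _.
  rewrite -mulr_suml sumrB sumr_const card_ord -mulr_natl he; ring.
rewrite (fe_residual_normal_equations re) add0r.
by rewrite (hb (fun g => - a' g) (fun t => - c' t)) addr0.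
Qed.

End LeastSquares.

(** * Conditioning on a design with finitely many values *)

(** Since [X] takes finitely many values, any [V] that depends on [X] alone factors through a finite
    type, which settles its measurability. *)
Lemma is_condexp_finite_range_pull_out (d : measure_display)
    (Om : measurableType d) (R : realType) (P : probability Om R)
    (J : finType) (X : J -> Om -> R) (V Y Z : Om -> R) :
  (forall j, measurable_fun setT (X j)) ->
  (forall j, finite_set (range (X j))) ->
  (forall w w', (forall j, X j w = X j w') -> V w = V w') ->
  P.-integrable setT (EFin \o Y) -> is_condexp P X Y Z ->
  P.-integrable setT (EFin \o (fun w => V w * Y w)) /\
  is_condexp P X (fun w => V w * Y w) (fun w => V w * Z w).
Proof.
move=> mX fX hV iY cY.
(* One finite list holding the values of every [X j] lets the whole vector be coded in a finite
   type. *)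
have [s hs] : exists s : seq R, forall j w, X j w \in s.
  have /choice[s hs] : forall j, exists s : seq R, range (X j) = [set` s].
    by move=> j; exact/finite_seqP.
  exists (flatten [seq s j | j <- enum J]) => j w.
  apply/flattenP; exists (s j); first by rewrite map_f// mem_enum.
  by have : range (X j) (X j w) by []; rewrite hs.
pose K w : {ffun J -> seq_sub s} := [ffun j => SeqSub (hs j w)].
have XK w j : X j w = val (K w j) by rewrite ffunE.
(* By [hV] the value does not depend on the point chosen in the fibre; the default 0 concerns only
   codes never attained. *)
pose v k := xget 0 [set V w | w in K @^-1` [set k]].
have VK w : V w = v (K w).
  rewrite /v; case: xgetP => [_ _ [w' /= KK <-]|/(_ (V w))[]]; last by exists w.
  by apply: hV => j; rewrite !XK KK.
have E (U : Om -> R) : (fun w => V w * U w) = (fun w => v (K w) * U w).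
  by apply/funext => w; rewrite VK.
rewrite !E; apply: is_condexp_pull_out => // k.
have -> : K @^-1` [set k] = \bigcap_(j in setT) X j @^-1` [set val (k j)].
  apply/seteqP; split=> w /= => [<- j _|h]; first by rewrite /= XK.
  by apply/ffunP => j; apply/val_inj; rewrite -XK h.
apply: (@fin_bigcap_measurable _ (g_sigma_algebraType (preimages X))) => // j _.
by apply: sub_sigma_algebra; exists j, [set val (k j)].
Qed.

Lemma finite_range_cell_avg (R : realType) (G T : nat) (N : 'I_G -> 'I_T -> nat)
    (Om : Type) (D : unit_data N (Om -> bool)) (g : 'I_G) (t : 'I_T) :
  finite_set (range (fun w => cell_avg (fun g t i => (D g t i w)%:R : R) g t)).
Proof.
pose f (b : {ffun 'I_(N g t) -> bool}) : R := (N g t)%:R^-1 * \sum_i (b i)%:R.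
apply: (@sub_finite_set _ _ (range f)) => [_ [w _ <-]|]; last first.
  by apply: finite_image; exact: finite_finset.
exists [ffun i => D g t i w] => //; rewrite /f /cell_avg.
by congr (_ * _); apply: eq_bigr => i _; rewrite ffunE.
Qed.

(** Mean independence reduces conditioning to the group's own treatments; strong exogeneity then
    makes the increments deterministic, and parallel trends makes them common to all groups. Summing
    them from the first period leaves the first-period conditional mean as group term. *)
Lemma condexp_parallel_trends (d : measure_display) (Om : measurableType d)
    (R : realType) (P : probability Om R) (G T : nat)
    (X Y : 'I_G -> 'I_T -> Om -> R) :
  (forall g t, measurable_fun setT (X g t)) ->
  (forall g t, P.-integrable setT (EFin \o Y g t)) ->
  (forall g t, \forall w \ae P,
    condexp P (fun c : 'I_G * 'I_T => X c.1 c.2) (Y g t) w =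
    condexp P (X g) (Y g t) w) ->
  (forall g (t s : 'I_T), t = s.+1 :> nat -> \forall w \ae P,
    (condexp P (X g) (fun v => Y g t v - Y g s v) w)%:E =
    ('E_P[(fun v => Y g t v - Y g s v)%R])%E) ->
  (forall g k (t s : 'I_T), t = s.+1 :> nat ->
    ('E_P[(fun w => Y g t w - Y g s w)%R] =
     'E_P[(fun w => Y k t w - Y k s w)%R])%E) ->
  \forall w \ae P, exists (alpha : 'I_G -> R) (gam : 'I_T -> R), forall g t,
    condexp P (fun c : 'I_G * 'I_T => X c.1 c.2) (Y g t) w = alpha g + gam t.
Proof.
(* Nonempty index types provide a first period and a reference group; otherwise the claim is
   vacuous. *)
case: T => [|T] in X Y *.
  by move=> *; apply: aeW => w; exists (fun=> 0), (fun=> 0) => g [].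
case: G => [|G] in X Y *.
  by move=> *; apply: aeW => w; exists (fun=> 0), (fun=> 0) => -[].
move=> mX iY mi se pt.
pose Z g t := condexp P (fun c : 'I_G.+1 * 'I_T.+1 => X c.1 c.2) (Y g t).
pose lam (t s : 'I_T.+1) := fine ('E_P[(fun v => Y ord0 t v - Y ord0 s v)%R])%E.
have step g (t s : 'I_T.+1) : t = s.+1 :> nat ->
    \forall w \ae P, Z g t w = Z g s w + lam t s.
  move=> ts.
  have B := condexpB (mX g) (iY g t) (iY g s).
  have St := se g _ _ ts.
  have M : \forall w \ae P, Z g t w = condexp P (X g) (Y g t) w /\
      Z g s w = condexp P (X g) (Y g s) w.
    by apply: filterI; exact: mi.
  move: B St M; apply: filterS3 => w Bw Sw [tw sw].
  by rewrite tw sw /lam -(pt g _ _ _ ts) -Sw /= Bw addrC subrK.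
(* Choosing [c] before the group makes the cumulated trend a pure period term; it starts at 0 and
   gains one increment per period. *)
have /choice[gam hgam] : forall t : 'I_T.+1, exists c : R, forall g,
    \forall w \ae P, Z g t w = Z g ord0 w + c.
  case; elim=> [|n IH] tT.
    exists 0 => g; apply: aeW => w; rewrite addr0.
    by congr (Z _ _ _); apply/val_inj.
  have [c hc] := IH (ltnW tT).
  exists (c + lam (Ordinal tT) (Ordinal (ltnW tT))) => g.
  have := step g (Ordinal tT) (Ordinal (ltnW tT)) erefl.
  by apply: filterS2 (hc g) => w -> ->; rewrite addrA.
have : \forall w \ae P, forall t g, Z g t w = Z g ord0 w + gam t.
  by apply: filter_forall => t; apply: filter_forall => g; exact: hgam.
apply: filterS => w h.
by exists (fun g => Z g ord0 w), gam => g t; exact: h.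
Qed.

(** * Expectation of the fixed effects estimator *)

Theorem proposition2 (R : realType) (d : measure_display) (Om : measurableType d)
  (P : probability Om R) (G T : nat) (hT : (2 <= T)%N)
  (N : 'I_G -> 'I_T -> nat)
  (Y0 Y1 : unit_data N {RV P >-> R})
  (Dstar D : unit_data N {RV P >-> bool})
  (Y : unit_data N (Om -> R))
  (hY : forall g t i w, Y g t i w =
    (Dstar g t i w)%:R * Y1 g t i w + (1 - (Dstar g t i w)%:R) * Y0 g t i w)
  (Dc Y0c : 'I_G -> 'I_T -> Om -> R)
  (hDc : forall g t w, Dc g t w = cell_avg (fun g t i => (D g t i w)%:R) g t)
  (hY0c : forall g t w, Y0c g t w = cell_avg (fun g t i => Y0 g t i w) g t)
  (beta : {RV P >-> R})
  (hbeta : \forall w \ae P,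
    is_twfe_coef (fun g t i => Y g t i w) (fun g t i => (D g t i w)%:R) (beta w))
  (eps : 'I_G -> 'I_T -> Om -> R)
  (heps : forall w, is_fe_residual N (fun g t => Dc g t w) (fun g t => eps g t w))
  (N1 : Om -> R)
  (hN1 : forall w, N1 w = \sum_(g < G) \sum_(t < T) (N g t)%:R * Dc g t w)
  (hwd : \forall w \ae P,
    \sum_(g < G) \sum_(t < T) (N g t)%:R * eps g t w * Dc g t w != 0)
  (hint : forall g t, P.-integrable setT (EFin \o Y0c g t))
  (balanced : forall g t, (0 < N g t)%N)
  (sharp : forall g t i, \forall w \ae P, (D g t i w)%:R = Dc g t w)
  (mean_independence : forall g t, \forall w \ae P,
    condexp P (fun c : 'I_G * 'I_T => Dc c.1 c.2) (Y0c g t) w =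
    condexp P (Dc g) (Y0c g t) w)
  (strong_exogeneity : forall g (t s : 'I_T), t = s.+1 :> nat ->
    \forall w \ae P,
      (condexp P (Dc g) (fun v => Y0c g t v - Y0c g s v) w)%:E =
      ('E_P[(fun v => Y0c g t v - Y0c g s v)%R])%E)
  (parallel_trends : forall g k (t s : 'I_T), t = s.+1 :> nat ->
    ('E_P[(fun w => Y0c g t w - Y0c g s w)%R] =
     'E_P[(fun w => Y0c k t w - Y0c k s w)%R])%E)
  (Delta : R)
  (homogeneous : forall g t i, \forall w \ae P, Y1 g t i w - Y0 g t i w = Delta)
  (hbeta_int : ('E_P[fun w => `|beta w|%R] < +oo)%E) :
  ('E_P[beta] =
   Delta%:E * 'E_P[(fun w =>
     (\sum_(g < G) \sum_(t < T)
        (N g t)%:R / N1 w * eps g t w *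
        ((N g t)%:R^-1 *
         \sum_(i < N g t)
           condprob P (fun c : 'I_G * 'I_T => Dc c.1 c.2)
             [set v | Dstar g t i v = true] w)) /
     (\sum_(g < G) \sum_(t < T) (N g t)%:R / N1 w * eps g t w * Dc g t w))%R])%E.
Proof.
pose X (c : 'I_G * 'I_T) := Dc c.1 c.2.
pose den w := \sum_g \sum_t (N g t)%:R / N1 w * eps g t w * Dc g t w.
(* [V] collects all that multiplies a cell average in the estimator, denominator included. *)
pose V (c : 'I_G * 'I_T) w := (N c.1 c.2)%:R / N1 w * eps c.1 c.2 w / den w.
pose A g t i := [set v | Dstar g t i v = true].
pose S (c : 'I_G * 'I_T) w := cell_avg (fun g t i => \1_(A g t i) w : R) c.1 c.2.
pose S' (c : 'I_G * 'I_T) w :=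
  cell_avg (fun g t i => condprob P X (A g t i) w) c.1 c.2.
pose Y' (c : 'I_G * 'I_T) := Y0c c.1 c.2.
have N_neq0 g t : (N g t)%:R != 0 :> R by rewrite pnatr_eq0 -lt0n.
have mA g t i : measurable (A g t i).
  rewrite -[A g t i]setTI.
  have mDstar := measurable_funPT (Dstar g t i).
  exact: (mDstar measurableT [set true]).
have mDc g t : measurable_fun setT (Dc g t).
  have -> : Dc g t = (fun w => (N g t)%:R^-1 * \sum_(i < N g t) (D g t i w)%:R).
    by apply/funext => w; exact: hDc.
  apply: measurable_funM => //; apply: measurable_sum => i.
  have mb : measurable_fun setT (fun b : bool => b%:R : R) by [].
  exact: (measurableT_comp mb).
have mX c : measurable_fun setT (X c) by exact: mDc.
have fX c : finite_set (range (X c)).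
  have -> : X c = (fun w => cell_avg (fun g t i => (D g t i w)%:R) c.1 c.2).
    by apply/funext => w; exact: hDc.
  exact: finite_range_cell_avg.
(* The weights are functions of the observed design: the residuals by their uniqueness, the other
   ingredients by their formulas. *)
have hV c w w' : (forall j, X j w = X j w') -> V c w = V c w'.
  move=> XX; have DD g t : Dc g t w = Dc g t w' := XX (g, t).
  have NN : N1 w = N1 w'.
    by rewrite !hN1; apply: eq_bigr => g _; apply: eq_bigr => t _; rewrite DD.
  have EE : (fun g t => eps g t w) = (fun g t => eps g t w').
    apply: (fe_residual_unique balanced (heps w)).
    have -> : (fun g t => Dc g t w) = (fun g t => Dc g t w') by do 2 apply/funext => ?.
    exact: heps.
  have {}EE g t : eps g t w = eps g t w' by move/funeqP: EE => /(_ g)/funeqP/(_ t).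
  rewrite /V /den NN EE; congr (_ / _).
  by apply: eq_bigr => g _; apply: eq_bigr => t _; rewrite EE DD.
have iA g t i : P.-integrable setT (EFin \o \1_(A g t i)).
  by apply: integrable_indic => //; rewrite (le_lt_trans (probability_le1 _ _))// ltry.
have cS c : P.-integrable setT (EFin \o S c) /\ is_condexp P X (S c) (S' c).
  have [iS cS] := is_condexp_sum mX (index_enum 'I_(N c.1 c.2))
    (iA c.1 c.2) (fun i => condexpP mX (iA c.1 c.2 i)).
  split; first exact: (integrable_EFinZ (N c.1 c.2)%:R^-1 iS).
  exact: (is_condexpZ mX (N c.1 c.2)%:R^-1 iS cS).
have cY c : is_condexp P X (Y' c) (condexp P X (Y' c)).
  exact: condexpP (hint c.1 c.2).
have pull (U Z : 'I_G * 'I_T -> Om -> R) :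
    (forall c, P.-integrable setT (EFin \o U c)) ->
    (forall c, is_condexp P X (U c) (Z c)) ->
    P.-integrable setT (EFin \o (fun w => \sum_c V c w * U c w)) /\
    is_condexp P X (fun w => \sum_c V c w * U c w) (fun w => \sum_c V c w * Z c w).
  move=> iU cU; apply: (is_condexp_sum mX) => c.
    exact: (is_condexp_finite_range_pull_out mX fX (hV c) (iU c) (cU c)).1.
  exact: (is_condexp_finite_range_pull_out mX fX (hV c) (iU c) (cU c)).2.
have [iVS cVS] := pull _ _ (fun c => (cS c).1) (fun c => (cS c).2).
have [iVY cVY] := pull _ _ (fun c => hint c.1 c.2) cY.
have iDVS := integrable_EFinZ Delta iVS.
(* Conditioning the cell form of the estimator keeps the weights and replaces untreated outcomes and
   true treatment shares by their conditional versions. *)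
have [_ itot htot] := is_condexpD mX iVY iDVS cVY (is_condexpZ mX Delta iVS cVS).
have iVS' : P.-integrable setT (EFin \o (fun w => \sum_c V c w * S' c w)).
  by case: cVS.
(* Frisch-Waugh-Lovell divided by the nonzero denominator, each outcome being [Y0 + Delta * Dstar]
   under homogeneous effects. *)
have beta_ae : \forall w \ae P, beta w =
    \sum_c V c w * Y' c w + Delta * (\sum_c V c w * S c w).
  have sharp_all : \forall w \ae P, forall g t i, (D g t i w)%:R = Dc g t w.
    apply: filter_forall => g; apply: filter_forall => t.
    by apply: filter_forall => i.
  have homog_all : \forall w \ae P, forall g t i, Y1 g t i w - Y0 g t i w = Delta.
    apply: filter_forall => g; apply: filter_forall => t.
    by apply: filter_forall => i.
  have sharp_homog : \forall w \ae P, (forall g t i, (D g t i w)%:R = Dc g t w) /\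
      (forall g t i, Y1 g t i w - Y0 g t i w = Delta).
    exact: filterI.
  move: hbeta hwd sharp_homog.
  apply: filterS3 => w hb den0 [sh ho].
  have DE : (fun g t i => (D g t i w)%:R : R) = (fun g t (_ : 'I_(N g t)) => Dc g t w).
    by do 2 (apply/functional_extensionality_dep => ?); apply/funext => i.
  rewrite DE in hb; have F := frisch_waugh_lovell hb (heps w).
  (* If [N1 w] were 0, its nonnegative terms would all vanish, and with them the denominator that
     [den0] keeps away from 0. *)
  have N1_neq0 : N1 w != 0.
    apply: contra den0 => /eqP N10.
    have Dc_ge0 g t : 0 <= (N g t)%:R * Dc g t w.
      rewrite mulr_ge0// hDc mulr_ge0 ?invr_ge0// sumr_ge0// => i _.
    have Sg := psumr_eq0P (fun g _ => sumr_ge0 _ (fun t _ => Dc_ge0 g t))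
      (etrans (esym (hN1 w)) N10).
    rewrite big1// => g _; rewrite big1// => t _.
    have ND : (N g t)%:R * Dc g t w = 0.
      exact: (psumr_eq0P (fun t _ => Dc_ge0 g t) (Sg g isT)).
    by rewrite mulrAC ND mul0r.
  have denE : den w = (\sum_g \sum_t (N g t)%:R * eps g t w * Dc g t w) / N1 w.
    rewrite mulr_suml; apply: eq_bigr => g _; rewrite mulr_suml.
    by apply: eq_bigr => t _; ring.
  apply: (mulIf den0); rewrite F mulrDl -mulrA !mulr_suml mulr_sumr -big_split/=.
  rewrite pair_bigA/=; apply: eq_bigr => -[g t] _ /=.
  have -> : \sum_(i < N g t) Y g t i w =
      (N g t)%:R * (Y0c g t w + Delta * S (g, t) w).
    rewrite hY0c /S /cell_avg/= mulrDr (mulrCA _ Delta) !mulVKf//.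
    rewrite mulr_sumr -big_split/=; apply: eq_bigr => i _.
    have -> : \1_(A g t i) w = (Dstar g t i w)%:R :> R.
      by rewrite indicE /A; congr (nat_of_bool _)%:R; apply/idP/idP; rewrite inE.
    by rewrite hY -(ho g t i); ring.
  rewrite /V /= denE /Y'; field.
  by rewrite N1_neq0 den0.
(* The conditional means of the untreated outcomes are additive in group and period, hence
   annihilated by the residual weights. *)
have resid_ae : \forall w \ae P, \sum_c V c w * condexp P X (Y' c) w = 0.
  have := condexp_parallel_trends mDc hint mean_independence strong_exogeneity
    parallel_trends.
  apply: filterS => w [alpha [gam h]].
  have := fe_residual_normal_equations (heps w) alpha gam.
  rewrite pair_bigA/= => e0.
  rewrite -[RHS](mulr0 ((N1 w)^-1 / den w)) -[in RHS]e0 mulr_sumr.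
  by apply: eq_bigr => c _; rewrite /Y' h /V; ring.
rewrite !expectation.unlock.
transitivity (\int[P]_w
    (\sum_c V c w * Y' c w + Delta * (\sum_c V c w * S c w))%:E)%E.
  apply: ae_eq_integral => //.
  - exact/measurable_EFinP.
  - exact: (measurable_int _ (integrable_EFinD iVY iDVS)).
  - by apply: filterS beta_ae => w -> _.
(* The whole space is an event generated by the design, so the cell form and its conditional
   expectation have the same integral. *)
rewrite -htot; last exact: (@measurableT _ (g_sigma_algebraType (preimages X))).
(* The untreated outcomes drop out by [resid_ae]. *)
transitivity (\int[P]_w (Delta%:E * (\sum_c V c w * S' c w)%:E))%E.
  apply: ae_eq_integral => //.
  - exact: (measurable_int _ itot).
  - exact: (measurable_int _ (integrable_EFinZ Delta iVS')).
  - by apply: filterS resid_ae => w -> _; rewrite add0r.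
rewrite integralZl//; congr (_ * _)%E; apply: eq_integral => w _; congr EFin.
rewrite [in RHS]pair_bigA/= mulr_suml; apply: eq_bigr => c _.
by rewrite mulrAC.
Qed.
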